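(* Let $1 \leq k < r$ be integers and let $H$ be an $r$-uniform hypergraph. Then $$\gamma(H) - k + 1 \leq \iota(H, K_k^r) \leq \gamma(H).$$ Moreover, for every integer $q \geq 1$, there exist two connected $r$-uniform hypergraphs $H$ and $I$ such that $\iota(H, K_k^r) = \gamma(H) = q = \iota(I, K_k^r) = \gamma(I) - k + 1$.
   Context: A hypergraph $H$ is a pair $(V(H), E(H))$ with $E(H)$ a family of subsets of the finite set $V(H)$; it is $r$-uniform if every edge has exactly $r$ elements. $w \neq v$ is a neighbour of $v$ if $v,w \in e$ for some edge $e$; $N_H[v]$ is $v$ together with its neighbours, and $N_H[D] = \bigcup_{v \in D} N_H[v]$. $H$ is connected if for all distinct $v,w \in V(H)$ there are edges $e_1,\dots,e_t$ with $v \in e_1$, $w \in e_t$, $e_i \cap e_{i+1} \neq \emptyset$. $K_k^r$ is the $r$-graph with vertex set $[k]=\{1,\dots,k\}$ and edge set the family of $r$-subsets of $[k]$ (so for $k<r$ it has no edges). A copy of $F$ is a hypergraph obtained by bijectively relabelling the vertices of $F$; $H$ contains $F'$ if $V(F') \subseteq V(H)$ and $E(F')\subseteq E(H)$. $D \subseteq V(H)$ is a $K_k^r$-isolating set of $H$ if $N_H[D]$ meets the vertex set of every copy of $K_k^r$ contained by $H$; $\iota(H,K_k^r)$ is the minimum size of such a set. $D$ is a dominating set if $N_H[D] = V(H)$, and $\gamma(H)$ is the minimum size of a dominating set. *)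

(* Defs.v *)
From HB Require Import structures.
From mathcomp Require Import all_boot all_order all_algebra.

Set Implicit Arguments.
Unset Strict Implicit.
Unset Printing Implicit Defensive.

(* The vertex set is a subset of an ambient finite type, so that hypergraphs *)
(* with different vertex sets can be compared by inclusion.                  *)
Record hypergraph (T : finType) := Hypergraph {
  hypergraph_data : {set T} * {set {set T}};
  hypergraph_axiom :
    [forall e in hypergraph_data.2, e \subset hypergraph_data.1]
}.

HB.instance Definition _ (T : finType) :=
  [isSub for @hypergraph_data T].
HB.instance Definition _ (T : finType) :=
  [Finite of hypergraph T by <:].

Definition verts (T : finType) (H : hypergraph T) : {set T} :=
  (hypergraph_data H).1.
Definition edges (T : finType) (H : hypergraph T) : {set {set T}} :=
  (hypergraph_data H).2.

Definition uniform (T : finType) (r : nat) (H : hypergraph T) : bool :=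
  [forall e in edges H, #|e| == r].

Definition neighbour (T : finType) (H : hypergraph T) (v w : T) : bool :=
  (w != v) && [exists e in edges H, (v \in e) && (w \in e)].

Definition closed_nbhd (T : finType) (H : hypergraph T) (v : T) : {set T} :=
  v |: [set w | neighbour H v w].

Definition closed_nbhd_set (T : finType) (H : hypergraph T) (D : {set T}) :
    {set T} :=
  \bigcup_(v in D) closed_nbhd H v.

(* The edges e_1, ..., e_t are the sequence e :: s. *)
Definition connected (T : finType) (H : hypergraph T) : Prop :=
  forall v w : T, v \in verts H -> w \in verts H -> v != w ->
  exists (e : {set T}) (s : seq {set T}),
    [/\ {subset e :: s <= edges H}, v \in e, w \in last e s
      & path (fun e1 e2 => e1 :&: e2 != set0) e s].

Lemma complete_hypergraph_subproof (k r : nat) :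
  let d := ([set: 'I_k], [set e : {set 'I_k} | #|e| == r]) in
  [forall e in d.2, e \subset d.1].
Proof. by apply/forall_inP => e _; apply: subsetT. Qed.

(* K_k^r, with vertices numbered from 0. *)
Definition complete_hypergraph (k r : nat) : hypergraph 'I_k :=
  Hypergraph (complete_hypergraph_subproof k r).

Definition is_copy (U T : finType) (F : hypergraph U) (F' : hypergraph T) :
    bool :=
  [exists f : {ffun U -> T},
    [&& dinjectiveb f (mem (verts F)),
        verts F' == [set f x | x in verts F]
      & edges F' == [set f @: (e : {set U}) | e in edges F]]].

Definition contains (T : finType) (H F' : hypergraph T) : bool :=
  (verts F' \subset verts H) && (edges F' \subset edges H).

Definition isolating (U T : finType) (F : hypergraph U) (H : hypergraph T)
    (D : {set T}) : bool :=
  (D \subset verts H) &&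
  [forall F' : hypergraph T, is_copy F F' && contains H F' ==>
     (closed_nbhd_set H D :&: verts F' != set0)].

Definition dominating (T : finType) (H : hypergraph T) (D : {set T}) : bool :=
  (D \subset verts H) && (closed_nbhd_set H D == verts H).

Lemma closed_nbhd_set_verts (T : finType) (H : hypergraph T) :
  closed_nbhd_set H (verts H) = verts H.
Proof.
apply/setP=> w; apply/bigcupP/idP => [[v vH]|wH]; last first.
  by exists w => //; rewrite !inE eqxx.
rewrite !inE => /orP[/eqP -> //|/andP[_ /exists_inP[e eH /andP[_ we]]]].
by have /forall_inP/(_ e eH)/subsetP := hypergraph_axiom H; apply.
Qed.

Lemma dominating_verts (T : finType) (H : hypergraph T) :
  dominating H (verts H).
Proof. by rewrite /dominating subxx closed_nbhd_set_verts eqxx. Qed.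

Lemma isolating_verts (U T : finType) (F : hypergraph U) (H : hypergraph T) :
  verts F != set0 -> isolating F H (verts H).
Proof.
move=> /set0Pn[x xF]; rewrite /isolating subxx closed_nbhd_set_verts /=.
apply/forallP=> F'; apply/implyP=> /andP[/existsP[f /and3P[_ /eqP VF' _]]].
case/andP=> sF'H _; rewrite (setIidPr sF'H) VF'.
by apply/set0Pn; exists (f x); apply: imset_f.
Qed.

Definition domination_number (T : finType) (H : hypergraph T) : nat :=
  #|[arg min_(D < verts H | dominating H D) #|D|]|.

(* A genuine minimum whenever F has a vertex, by isolating_verts; if F has *)
(* no vertex there is no isolating set and the value is meaningless.       *)
Definition isolation_number (U T : finType) (H : hypergraph T)
    (F : hypergraph U) : nat :=
  #|[arg min_(D < verts H | isolating F H D) #|D|]|.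

(* Main.v *)
(** A copy of [K_k^r] with [k < r] is just a set of [k] vertices, so [D] is
    isolating iff [N[D]] misses fewer than [k] vertices; adding the missed
    vertices to [D] yields a dominating set.

    For the extremal examples take [q] disjoint edges [e_i] with a marked vertex
    [x_i], [m] disjoint edges [g_j] with a marked vertex [y_j], and a set [Z] of
    [r - 1] further vertices, then link them by the edges [x_i + Z] and
    [x_i + (g_j - y_j)].  The vertices of [e_i - x_i] have no neighbour outside
    [e_i], and those of [y_j] all lie in [g_j], so domination needs one vertex in
    each [e_i] and [g_j], and isolation one in each [e_i]; on the other hand the
    [x_i] miss only the [y_j].  Hence [m = 0] gives [gamma = iota = q], and
    [m = k - 1] gives [gamma = q + k - 1], [iota = q]. *)

Require Import Defs.
From mathcomp Require Import all_boot all_order all_algebra.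
From mathcomp Require Import zify.

Set Implicit Arguments.
Unset Strict Implicit.
Unset Printing Implicit Defensive.

Import GRing.Theory Num.Theory.

Lemma complete_edges0 k r : k < r -> edges (complete_hypergraph k r) = set0.
Proof.
move=> ltkr; apply/setP => e; rewrite !inE; apply/eqP => er.
by have := max_card e; rewrite er card_ord leqNgt ltkr.
Qed.

(** * Domination and isolation in an arbitrary hypergraph *)

Section Numbers.
Variables (T : finType) (H : hypergraph T).
Implicit Type D : {set T}.

Lemma closed_nbhdP (v w : T) :
  reflect (w = v \/ exists e, [/\ e \in edges H, v \in e & w \in e])
          (w \in closed_nbhd H v).
Proof.
rewrite !inE /neighbour; have [->|/eqP wv] := eqVneq w v; first by left; left.
apply: (iffP exists_inP) => [[e eH /andP[ve we]]|[/wv //|[e [eH ve we]]]].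
  by right; exists e.
by exists e; rewrite ?ve.
Qed.

Lemma closed_nbhd_setS D D' :
  D \subset D' -> closed_nbhd_set H D \subset closed_nbhd_set H D'.
Proof.
move=> /subsetP sDD'; apply/bigcupsP => v vD.
exact: bigcup_sup (sDD' v vD).
Qed.

Lemma sub_closed_nbhd_set D : D \subset closed_nbhd_set H D.
Proof.
by apply/subsetP => v vD; apply/bigcupP; exists v => //; rewrite !inE eqxx.
Qed.

Lemma domination_le D : dominating H D -> domination_number H <= #|D|.
Proof.
move=> domD; rewrite /domination_number.
by case: arg_minnP => [|D' _ minD']; [apply: dominating_verts | apply: minD'].
Qed.

Lemma domination_witness :
  exists2 D, dominating H D & domination_number H = #|D|.
Proof.
rewrite /domination_number.
by case: arg_minnP => [|D domD _]; [apply: dominating_verts | exists D].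
Qed.

Lemma domination_le_undominated D :
  D \subset verts H ->
  domination_number H <= #|D| + #|verts H :\: closed_nbhd_set H D|.
Proof.
move=> sDV; set W := _ :\: _.
apply: leq_trans (leq_card_setU D W); apply: domination_le.
have sUV : D :|: W \subset verts H by rewrite subUset sDV subsetDl.
rewrite /dominating sUV eqEsubset -{1}(closed_nbhd_set_verts H).
rewrite closed_nbhd_setS //=; apply/subsetP => v vV.
case vN: (v \in closed_nbhd_set H D).
  exact: subsetP (closed_nbhd_setS (subsetUl _ _)) _ vN.
by apply: (subsetP (sub_closed_nbhd_set _)); rewrite !inE vN vV orbT.
Qed.

Section Isolation.
Variables k r : nat.
Hypotheses (k_gt0 : 0 < k) (ltkr : k < r).

Lemma isolatingE D :
  isolating (complete_hypergraph k r) H D =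
  (D \subset verts H) && (#|verts H :\: closed_nbhd_set H D| < k).
Proof.
rewrite /isolating; case: (D \subset verts H) => //=.
apply/forallP/idP => [isoD|ltWk F'].
- rewrite ltnNge; apply/negP => leW.
  have [S sSW cardS] : exists2 S : {set T},
      S \subset verts H :\: closed_nbhd_set H D & #|S| = k.
    have: 0 < #|[set A : {set T} | A \subset verts H :\: closed_nbhd_set H D
                                 & #|A| == k]|.
      by rewrite cards_draws bin_gt0.
    by case/card_gt0P => S; rewrite inE => /andP[? /eqP ?]; exists S.
  (* The edgeless hypergraph on [S] is a copy of $K_k^r$, which has no edges as $k < r$. *)
  have F'P : [forall e in (S, set0 : {set {set T}}).2, e \subset S].
    by apply/forall_inP => e; rewrite inE.
  have /implyP := isoD (Hypergraph F'P).
  rewrite /contains [verts (Hypergraph _)]/= [edges (Hypergraph _)]/=.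
  have copyS : is_copy (complete_hypergraph k r) (Hypergraph F'P).
    (* Replacing [k] by [#|S|] makes [enum_val] a bijection from the index type onto [S]. *)
    subst k; apply/existsP; exists [ffun i => enum_val i].
    rewrite complete_edges0 // imset0 eqxx andbT; apply/andP; split.
      by apply/dinjectiveP => i j _ _; rewrite !ffunE; apply: enum_val_inj.
    rewrite eqEsubset; apply/andP; split; apply/subsetP => v.
      move=> vS; apply/imsetP; exists (enum_rank_in vS v); rewrite ?inE //.
      by rewrite ffunE enum_rankK_in.
    by case/imsetP => i _ ->; rewrite ffunE enum_valP.
  rewrite copyS sub0set (subset_trans sSW (subsetDl _ _)) => /(_ isT).
  by rewrite setI_eq0 disjoint_sym; move: sSW; rewrite subsetD => /andP[_ ->].
- apply/implyP => /andP[/existsP[f /and3P[/dinjectiveP injf /eqP VF' _]]].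
  case/andP => sF'V _; apply/eqP => NF'0.
  have cardF' : #|verts F'| = k by rewrite VF' card_in_imset // cardsT card_ord.
  move: ltWk; rewrite ltnNge -cardF' subset_leq_card //.
  by rewrite subsetD sF'V -setI_eq0 setIC NF'0 /=.
Qed.

Lemma isolating_verts_complete : isolating (complete_hypergraph k r) H (verts H).
Proof.
by apply: isolating_verts; apply/set0Pn; exists (Ordinal k_gt0); rewrite inE.
Qed.

Lemma isolation_le D :
  isolating (complete_hypergraph k r) H D ->
  isolation_number H (complete_hypergraph k r) <= #|D|.
Proof.
move=> isoD; rewrite /isolation_number.
by case: arg_minnP => [|D' _ minD'];
  [apply: isolating_verts_complete | apply: minD'].
Qed.

Lemma isolation_witness :
  exists2 D, isolating (complete_hypergraph k r) H D
           & isolation_number H (complete_hypergraph k r) = #|D|.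
Proof.
rewrite /isolation_number.
by case: arg_minnP => [|D isoD _]; [apply: isolating_verts_complete | exists D].
Qed.

Lemma isolation_le_domination :
  isolation_number H (complete_hypergraph k r) <= domination_number H.
Proof.
have [D /andP[sDV /eqP NDV] ->] := domination_witness.
by apply: isolation_le; rewrite isolatingE sDV NDV setDv cards0.
Qed.

Lemma domination_lt_isolation :
  domination_number H < isolation_number H (complete_hypergraph k r) + k.
Proof.
have [D isoD ->] := isolation_witness.
move: isoD; rewrite isolatingE => /andP[sDV ltWk].
by apply: leq_ltn_trans (domination_le_undominated sDV) _; rewrite ltn_add2l.
Qed.

End Isolation.

(** * Connectivity through a hub edge *)

Definition incident (e1 e2 : {set T}) :=
  [&& e1 \in edges H, e2 \in edges H & e1 :&: e2 != set0].

Lemma incident_sym : symmetric incident.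
Proof. by move=> e1 e2; rewrite /incident setIC andbCA. Qed.

(** Incidence is symmetric, so walks from two vertices to [h] can be glued at [h]. *)
Lemma connected_through (h : {set T}) :
  h \in edges H ->
  (forall v, v \in verts H -> exists2 e : {set T}, v \in e & connect incident e h) ->
  connected H.
Proof.
move=> hH to_h v w /to_h[e ve eh] /to_h[e' we' e'h] _.
(* [connect] is reflexive on all sets, so two cases arise: [e] is [h], or a first step of the walk
   puts [e] in [edges H]. *)
have eH : e \in edges H.
  by case/connectP: eh => [[|e1 s] /= ]; [move=> _ <- | case/andP=> /and3P[]].
have: connect incident e e'.
  by apply: connect_trans eh _; rewrite (sym_connect_sym incident_sym).
case/connectP => s ps e's; exists e, s; split=> //; last 1 first.
- by apply: sub_path ps => e1 e2 /and3P[].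
- move=> e1; rewrite inE => /predU1P[-> //|e1s].
  by case/splitPr: e1s ps {e's} => s1 s2; rewrite cat_path /= => /and3P[_ /and3P[]].
by rewrite -e's.
Qed.

End Numbers.

(** * The extremal hypergraphs *)

Section Gadget.
(* The vertex [(inr None, ord0)] of the ambient type is not in the hypergraph:
   [Z] is the block [inr None] without it. The marked vertices are those with
   second component [ord0]. Here [r = n.+1], and there are [q.+1] edges [e_i]. *)
Variables q m n : nat.
Let block := ('I_q.+1 + option 'I_m)%type.
Let point := (block * 'I_n.+1)%type.

(** Each edge of the gadget is the graph of a function from coordinates to blocks: constant for
    $e_i$ and $g_j$, [link] for the others. *)
Definition section (g : 'I_n.+1 -> block) : {set point} :=
  [set (g t, t) | t in 'I_n.+1].

Lemma in_section g p : (p \in section g) = (p.1 == g p.2).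
Proof.
case: p => b t; apply/imsetP/eqP => [[t' _ [-> ->]] //|/= ->].
by exists t.
Qed.

Lemma card_section g : #|section g| = n.+1.
Proof. by rewrite card_imset ?card_ord // => t t' []. Qed.

(** This gives $x_i + Z$ for [o = None] and $x_i + (g_j - y_j)$ for [o = Some j]. *)
Definition link (i : 'I_q.+1) (o : option 'I_m) (t : 'I_n.+1) : block :=
  if t == ord0 then inl i else inr o.

Definition gadget_verts : {set point} := [set~ (inr None, ord0)].

Definition gadget_edges : {set {set point}} :=
  [set section (fun=> b) | b in [set~ inr None]]
  :|: [set section (link u.1 u.2) | u in {: 'I_q.+1 * option 'I_m}].

Lemma gadget_subproof :
  [forall e in (gadget_verts, gadget_edges).2, e \subset gadget_verts].
Proof.
apply/forall_inP => e /= /setUP[] /imsetP[b bP ->]; apply/subsetP => -[c t];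
  rewrite in_section !inE xpair_eqE /= => /eqP ->.
  by move: bP; rewrite !inE => /negPf ->.
by rewrite /link; have [_|_] := eqVneq t ord0; rewrite ?andbF.
Qed.

Definition gadget := Hypergraph gadget_subproof.

Lemma block_edge b : b != inr None -> section (fun=> b) \in edges gadget.
Proof. by move=> bP; apply/setUP; left; apply: imset_f; rewrite !inE. Qed.

Lemma link_edge i o : section (link i o) \in edges gadget.
Proof. by apply/setUP; right; apply/imsetP; exists (i, o). Qed.

Lemma gadget_uniform : uniform n.+1 gadget.
Proof.
by apply/forall_inP => e /setUP[] /imsetP[b _ ->]; rewrite card_section.
Qed.

(* The points on some edge [section (link i o)]. *)
Definition linked (p : point) :=
  (if p.1 is inl _ then true else false) == (p.2 == ord0).

Lemma unlinked_nbhd v w :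
  ~~ linked w -> w \in closed_nbhd gadget v -> v.1 = w.1.
Proof.
move=> wP /closed_nbhdP[-> //|[e [/setUP[] /imsetP[u _ ->]]]].
  by rewrite !in_section => /eqP -> /eqP ->.
rewrite !in_section => _ /eqP w1; move: wP; rewrite /linked w1 /link.
by have [_|_] := eqVneq w.2 ord0.
Qed.

(** Both lower bounds rest on this: projecting [D] to blocks does not increase its size, so it
    suffices to count the blocks that [D] must meet. *)
Lemma unlinked_dominated D w :
  ~~ linked w -> w \in closed_nbhd_set gadget D -> w.1 \in [set v.1 | v in D].
Proof.
by move=> wP /bigcupP[v vD /(unlinked_nbhd wP) <-]; apply: imset_f.
Qed.

Lemma gadget_undominated :
  exists D : {set point}, [/\ D \subset verts gadget, #|D| = q.+1
    & #|verts gadget :\: closed_nbhd_set gadget D| <= m].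
Proof.
pose x i : point := (inl i, ord0).
exists [set x i | i : 'I_q.+1]; split.
- by apply/subsetP => _ /imsetP[i _ ->]; rewrite !inE.
- by rewrite card_imset ?card_ord // => i j [].
pose y j : point := (inr (Some j), ord0).
have cardY : #|[set y j | j : 'I_m]| <= m.
  by rewrite -[leqRHS]card_ord leq_imset_card.
apply: leq_trans cardY; apply: subset_leq_card; apply/subsetP => w.
rewrite !inE andbC => /andP[w_neq /bigcupP wN].
(* An undominated [w] shares no edge with any $x_i$; the edges $e_i$ and the links from $x_0$ then
   leave only the $y_j$. *)
have xN i (e : {set point}) : e \in edges gadget -> x i \in e -> w \notin e.
  move=> eH xe; apply/negP => we; apply: wN.
  by exists (x i); [apply: imset_f | apply/closed_nbhdP; right; exists e].
case: w w_neq xN {wN} => [[i|o] t] w_neq xN.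
  have := xN i _ (@block_edge (inl i) isT).
  by rewrite !in_section /= !eqxx => /(_ isT).
have := xN ord0 _ (link_edge ord0 o); rewrite !in_section /link /= eqxx => /(_ isT).
have [t0 _|_] := eqVneq t ord0; last by rewrite eqxx.
case: o w_neq {xN} => [j _|]; last by rewrite t0 eqxx.
by rewrite t0; apply: (imset_f y).
Qed.

Hypothesis n_gt0 : 0 < n.

Lemma ord_max_neq0 : (ord_max : 'I_n.+1) != ord0.
Proof. by rewrite -val_eqE /= -lt0n. Qed.

(** The hub is $x_0 + Z$: $e_i$ reaches it via $x_i + Z$, and $g_j$ via $x_0 + (g_j - y_j)$. *)
Lemma gadget_connected : connected gadget.
Proof.
have hub := link_edge ord0 None.
have meet e1 e2 p : e1 \in edges gadget -> e2 \in edges gadget ->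
    p \in e1 -> p \in e2 -> connect (incident gadget) e1 e2.
  move=> e1H e2H pe1 pe2; apply: connect1; rewrite /incident e1H e2H.
  by apply/set0Pn; exists p; rewrite inE pe1.
apply: (connected_through hub) => [[[i|[j|]] t]] tV.
- have bi : inl i != inr None :> block by [].
  exists (section (fun=> inl i)); first by rewrite in_section.
  apply: (@connect_trans _ _ (section (link i None))).
    apply: (meet _ _ (inl i, ord0)); rewrite ?block_edge ?link_edge //;
      by rewrite in_section /link /= ?eqxx.
  apply: (meet _ _ (inr None, ord_max)); rewrite ?link_edge //;
    by rewrite in_section /link /= (negPf ord_max_neq0).
- have bj : inr (Some j) != inr None :> block by [].
  exists (section (fun=> inr (Some j))); first by rewrite in_section.
  apply: (@connect_trans _ _ (section (link ord0 (Some j)))).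
    apply: (meet _ _ (inr (Some j), ord_max)); rewrite ?block_edge ?link_edge //;
      by rewrite in_section /link /= ?(negPf ord_max_neq0).
  apply: (meet _ _ (inl ord0, ord0)); rewrite ?link_edge //;
    by rewrite in_section /link /= eqxx.
- exists (section (link ord0 None)); last exact: connect0.
  by move: tV; rewrite in_section /link !inE /= xpair_eqE eqxx /= => /negPf ->.
Qed.

Lemma gadget_domination_ge : q.+1 + m <= domination_number gadget.
Proof.
have [D /andP[_ /eqP NDV] ->] := domination_witness gadget.
have card_blocks : #|[set~ inr None : block]| = (q.+1 + m)%N.
  by rewrite cardsC1 card_sum card_option !card_ord addnS.
rewrite -[leqLHS]card_blocks; apply: leq_trans (leq_imset_card fst _).
apply: subset_leq_card.
apply/subsetP => b; rewrite !inE => bP.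
(* An unmarked vertex serves in $e_i$, and $y_j$ in $g_j$. *)
have [t wP] : exists t, ~~ linked (b, t).
  case: b {bP} => o; last by exists ord0.
  by exists ord_max; rewrite /linked /= (negPf ord_max_neq0).
have wV : (b, t) \in verts gadget by rewrite !inE xpair_eqE (negPf bP).
by apply: (unlinked_dominated wP); rewrite NDV.
Qed.

(** If [D] misses the block $e_i$, all $n \geq k$ vertices of $e_i - x_i$ stay undominated, which is
    too many. *)
Lemma gadget_isolation_ge k :
  0 < k <= n -> q.+1 <= isolation_number gadget (complete_hypergraph k n.+1).
Proof.
case/andP => k_gt0 lekn.
have [D isoD ->] := isolation_witness gadget n.+1 k_gt0.
move: isoD; rewrite isolatingE // => /andP[_]; rewrite ltnNge => ltWk.
have card_inl : #|[set (inl i : block) | i : 'I_q.+1]| = q.+1.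
  by rewrite card_imset ?card_ord // => i j [].
rewrite -[leqLHS]card_inl; apply: leq_trans (leq_imset_card fst _).
apply: subset_leq_card.
apply/subsetP => _ /imsetP[i _ ->]; apply: contraR ltWk => iD.
apply: leq_trans lekn _.
have card_unlinked : #|[set ((inl i, lift ord0 t) : point) | t : 'I_n]| = n.
  by rewrite card_imset ?card_ord // => t t' /(congr1 snd)/lift_inj.
rewrite -[leqLHS]card_unlinked; apply: subset_leq_card.
apply/subsetP => _ /imsetP[t _ ->].
rewrite !inE andbT; apply: contra iD.
exact: (@unlinked_dominated D (inl i, lift ord0 t)).
Qed.

End Gadget.

(** * The bounds and their sharpness *)

Local Open Scope ring_scope.

Theorem theorem3p2 (k r : nat) (hk : (1 <= k)%N) (hkr : (k < r)%N) :
  (forall (T : finType) (H : hypergraph T), uniform r H ->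
     (domination_number H)%:Z - k%:Z + 1
       <= (isolation_number H (complete_hypergraph k r))%:Z
     /\ (isolation_number H (complete_hypergraph k r))%:Z
       <= (domination_number H)%:Z)
  /\
  (forall q : nat, (1 <= q)%N ->
     exists (T U : finType) (H : hypergraph T) (I : hypergraph U),
       [/\ uniform r H /\ connected H,
           uniform r I /\ connected I,
           isolation_number H (complete_hypergraph k r) = q
             /\ domination_number H = q
         & isolation_number I (complete_hypergraph k r) = q
             /\ (domination_number I)%:Z - k%:Z + 1 = q%:Z]).
Proof.
split=> [T H _|[//|q] _].
  have := domination_lt_isolation H hk hkr.
  by have := isolation_le_domination H hk hkr; lia.
case: r hkr => // n hkr; have n_gt0 : (0 < n)%N := leq_trans hk hkr.
have k_in : (0 < k <= n)%N by rewrite hk.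
(* The $x_i$ leave at most $m < k$ vertices undominated, so they isolate. *)
have iso_eq m : (m < k)%N ->
    isolation_number (gadget q m n) (complete_hypergraph k n.+1) = q.+1.
  move=> ltmk; apply/eqP; rewrite eqn_leq gadget_isolation_ge // andbT.
  have [D [sDV cardD leW]] := gadget_undominated q m n.
  by rewrite -[leqRHS]cardD isolation_le // isolatingE // sDV (leq_ltn_trans leW).
have dom_eq m : domination_number (gadget q m n) = (q.+1 + m)%N.
  apply/eqP; rewrite eqn_leq gadget_domination_ge // andbT.
  have [D [sDV cardD leW]] := gadget_undominated q m n.
  by apply: leq_trans (domination_le_undominated sDV) _; rewrite cardD leq_add2l.
exists _, _, (gadget q 0 n), (gadget q k.-1 n).
split; try by split; [apply: gadget_uniform | apply: gadget_connected].
- by rewrite iso_eq // dom_eq addn0.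
- by rewrite iso_eq ?prednK // dom_eq; split=> //; lia.
Qed.
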